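(* Let $\{(X_n,x_n)\}_{n\ge1}$ be a sequence of pointed maximal Gromov product spaces, and let $(X,x)$ be a pointed maximal Gromov product space whose boundary $\partial_P X$ is finite. If $(X_n,x_n)\to(X,x)$ in the pointed Gromov-Hausdorff sense, then $(\partial_P X_n,\rho_{x_n})\to(\partial_P X,\rho_x)$ in the sense of almost-isometric convergence.
   Context: **Semi-metric and antipodal spaces.** A compact semi-metric space $(Z,\rho)$ is a compact metrizable space $Z$ with at least four points together with a continuous symmetric function $\rho:Z\times Z\to[0,\infty)$ with $\rho(\xi,\eta)=0$ iff $\xi=\eta$. It is an antipodal space if moreover $\sup_{\xi,\eta}\rho(\xi,\eta)=1$ and for every $\xi\in Z$ there is $\eta\in Z$ with $\rho(\xi,\eta)=1$. The cross-ratio is $[\xi,\xi',\eta,\eta']_\rho=\frac{\rho(\xi,\eta)\rho(\xi',\eta')}{\rho(\xi,\eta')\rho(\xi',\eta)}$ for distinct points; a Moebius homeomorphism is a homeomorphism preserving cross-ratios. **Gromov product spaces.** In a metric space $X$, $(y|z)_x=\frac12(d(y,x)+d(z,x)-d(y,z))$. A Gromov product space is a proper, geodesic, geodesically complete (every geodesic segment extends to a bi-infinite geodesic) metric space $X$ having a second countable Hausdorff compactification $\hat X$ such that for every $x\in X$ the Gromov product $(\cdot|\cdot)_x$ extends to a continuous function $\hat X\times\hat X\to[0,+\infty]$ and, for $\xi,\eta\in\hat X\setminus X$, $(\xi|\eta)_x=+\infty$ iff $\xi=\eta$. The compactification $\hat X$ is unique up to equivalence; $\partial_P X=\hat X\setminus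 X$ is the Gromov product boundary. For $x\in X$, $\rho_x=\exp(-(\cdot|\cdot)_x)$ on $\partial_P X$; $(\partial_P X,\rho_x)$ is an antipodal space (boundaries are understood to have at least four points), and the cross-ratio of $\rho_x$ does not depend on $x$. $X$ is a maximal Gromov product space if for every Gromov product space $Y$ and every Moebius homeomorphism $g:\partial_P Y\to\partial_P X$, $g$ extends to an isometric embedding $Y\to X$. **Almost-isometric (AI) convergence.** For $\epsilon>0$, an $\epsilon$-isometry $f:(Z_1,\rho_1)\to(Z_2,\rho_2)$ between compact semi-metric spaces is a (not necessarily continuous) map with $\sup_{\xi,\eta\in Z_1}|\rho_2(f(\xi),f(\eta))-\rho_1(\xi,\eta)|<\epsilon$ and such that every point $\eta\in Z_2$ satisfies $\rho_2(f(\zeta),\eta)<\epsilon$ for some $\zeta\in Z_1$. Let $d_{AI}((Z_1,\rho_1),(Z_2,\rho_2))$ be the infimum of $\epsilon>0$ for which there are $\epsilon$-isometries $Z_1\to Z_2$ and $Z_2\to Z_1$. AI-convergence $(Z_n,\rho_n)\to(Z,\rho_0)$ means $d_{AI}((Z_n,\rho_n),(Z,\rho_0))\to0$. **Pointed Gromov-Hausdorff convergence.** A map $f:X\to Y$ of metric spaces (not necessarily continuous) is an $\epsilon$-isometry if $\sup_{x_1,x_2}|d_Y(f(x_1),f(x_2))-d_X(x_1,x_2)|<\epsilon$ and $Y=\bigcup_{x\in X}B_Y(f(x),\epsilon)$. For pointed proper geodesic metric spaces, $(X_n,p_n)\to(X,p)$ means: for every $R>0$ and $\epsilon>0$ there is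 $n_0$ such that for all $n\ge n_0$ there is an $\epsilon$-isometry $f:B_{X_n}(p_n,R)\to B_X(p,R)$ with $f(p_n)=p$. Balls $B_X(p,R)$ are closed. *)

(* Defs.v *)
From HB Require Import structures.
From mathcomp Require Import all_boot all_order all_algebra.
From mathcomp Require Import all_classical all_reals all_analysis.

Set Implicit Arguments.
Unset Strict Implicit.
Unset Printing Implicit Defensive.

Import Order.TTheory GRing.Theory Num.Theory.
Import numFieldNormedType.Exports.

Local Open Scope classical_set_scope.
Local Open Scope ring_scope.

Section MetricNotions.
Context {R : realType} (X : metricType R).

Definition cball (p : X) (r : R) : set X := [set y | mdist p y <= r].

Definition proper_space : Prop := forall (p : X) (r : R), compact (cball p r).

Definition geodesic_on (I : set R) (c : R -> X) : Prop :=
  forall s t, I s -> I t -> mdist (c s) (c t) = `|s - t|.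

Definition geodesic_space : Prop :=
  forall x y : X, exists c : R -> X,
    [/\ geodesic_on `[0, mdist x y] c, c 0 = x & c (mdist x y) = y].

Definition geodesically_complete : Prop :=
  forall (a b : R) (c : R -> X), a <= b -> geodesic_on `[a, b] c ->
    exists2 c' : R -> X, geodesic_on setT c' &
      forall t, a <= t <= b -> c' t = c t.

Definition gromov_product (x y z : X) : R :=
  (mdist y x + mdist z x - mdist y z) / 2.

End MetricNotions.

(* [gpc_open] says that the topology of [X] is the one induced by [gpc_inj],
   so that [gpc_inj] is a homeomorphism onto its image.
   [gpc_prod x] is the extension of the Gromov product based at [x]. *)
Record gpCompactification (R : realType) (X : metricType R) := GpCompactification {
  gpc_space : topologicalType;
  gpc_compact : compact [set: gpc_space];
  gpc_hausdorff : hausdorff_space gpc_space;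
  gpc_second_countable : @second_countable gpc_space;
  gpc_inj : X -> gpc_space;
  gpc_injective : injective gpc_inj;
  gpc_open : forall U : set X,
    open U <-> exists2 V : set gpc_space, open V & gpc_inj @^-1` V = U;
  gpc_dense : dense (range gpc_inj);
  gpc_prod : X -> gpc_space -> gpc_space -> \bar R;
  gpc_prod_ge0 : forall x xi eta, (0 <= gpc_prod x xi eta)%E;
  gpc_prod_continuous : forall x,
    continuous (fun u : gpc_space * gpc_space => gpc_prod x u.1 u.2);
  gpc_prodE : forall x y z,
    gpc_prod x (gpc_inj y) (gpc_inj z) = (gromov_product x y z)%:E;
  gpc_prod_pinfty : forall x xi eta,
    (~` range gpc_inj) xi -> (~` range gpc_inj) eta ->
    gpc_prod x xi eta = +oo%E <-> xi = eta
}.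

(* The compactification is bundled as data; as it is unique up to equivalence,
   this amounts to asking for its existence. *)
Record gromovProductSpace (R : realType) := GromovProductSpace {
  gps_space :> metricType R;
  gps_proper : proper_space gps_space;
  gps_geodesic : geodesic_space gps_space;
  gps_complete : geodesically_complete gps_space;
  gps_compactification : gpCompactification gps_space;
  gps_four_points : exists s : 'I_4 -> ~` range (gpc_inj gps_compactification),
    injective s
}.

Definition hat (R : realType) (X : gromovProductSpace R) : topologicalType :=
  gpc_space (gps_compactification X).

Definition hat_inj (R : realType) (X : gromovProductSpace R) : X -> hat X :=
  @gpc_inj _ _ (gps_compactification X).

Definition boundary (R : realType) (X : gromovProductSpace R) : set (hat X) :=
  ~` range (@hat_inj R X).

Arguments boundary {R} X.

(* [expeR] sends [-oo] to 0 and the argument is never [+oo], so [fine] only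
   transports a finite value to [R]. *)
Definition boundary_rho (R : realType) (X : gromovProductSpace R) (x : X)
    (xi eta : boundary X) : R :=
  fine (expeR (- @gpc_prod _ _ (gps_compactification X)
                    x (\val xi) (\val eta))%E).

Definition homeomorphism (S T : topologicalType) (g : S -> T) : Prop :=
  continuous g /\
  exists h : T -> S, [/\ cancel g h, cancel h g & continuous h].

Definition cross_ratio (R : realType) (Z : Type) (rho : Z -> Z -> R)
    (a a' b b' : Z) : R :=
  (rho a b * rho a' b') / (rho a b' * rho a' b).

Definition preserves_cross_ratio (R : realType) (Z1 Z2 : eqType)
    (rho1 : Z1 -> Z1 -> R) (rho2 : Z2 -> Z2 -> R) (g : Z1 -> Z2) : Prop :=
  forall a a' b b' : Z1, uniq [:: a; a'; b; b'] ->
    cross_ratio rho2 (g a) (g a') (g b) (g b') = cross_ratio rho1 a a' b b'.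

(* The cross-ratio of [boundary_rho x] does not depend on [x], so quantifying
   over all base points is the same as choosing some. *)
Definition moebius_homeomorphism (R : realType) (Y X : gromovProductSpace R)
    (g : boundary Y -> boundary X) : Prop :=
  homeomorphism g /\
  forall (y : Y) (x : X),
    preserves_cross_ratio (boundary_rho y) (boundary_rho x) g.

(* [f] together with [g] is a continuous map of the compactifications. *)
Definition boundary_extension (R : realType) (Y X : gromovProductSpace R)
    (g : boundary Y -> boundary X) (f : Y -> X) : Prop :=
  exists F : hat Y -> hat X,
    [/\ continuous F,
        forall y : Y, F (hat_inj y) = hat_inj (f y) &
        forall xi : boundary Y, F (\val xi) = \val (g xi)].

Definition isometric_embedding (R : realType) (Y X : metricType R)
    (f : Y -> X) : Prop :=
  forall a b : Y, mdist (f a) (f b) = mdist a b.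

Definition maximal_gps (R : realType) (X : gromovProductSpace R) : Prop :=
  forall (Y : gromovProductSpace R) (g : boundary Y -> boundary X),
    moebius_homeomorphism g ->
    exists2 f : Y -> X, isometric_embedding f & boundary_extension g f.

(* AI-convergence only involves the underlying sets and the functions [rho],
   so the topologies of the semi-metric spaces do not appear below. *)
Section AlmostIsometric.
Context {R : realType}.

Definition ai_isometry (Z1 Z2 : Type) (rho1 : Z1 -> Z1 -> R)
    (rho2 : Z2 -> Z2 -> R) (eps : R) (f : Z1 -> Z2) : Prop :=
  (ereal_sup (range (fun u : Z1 * Z1 =>
     `|rho2 (f u.1) (f u.2) - rho1 u.1 u.2|%:E)) < eps%:E)%E /\
  forall eta : Z2, exists zeta : Z1, rho2 (f zeta) eta < eps.

Definition ai_dist (Z1 Z2 : Type) (rho1 : Z1 -> Z1 -> R)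
    (rho2 : Z2 -> Z2 -> R) : \bar R :=
  ereal_inf [set eps%:E | eps in [set eps : R |
    [/\ 0 < eps,
        exists f : Z1 -> Z2, ai_isometry rho1 rho2 eps f &
        exists g : Z2 -> Z1, ai_isometry rho2 rho1 eps g]]].

Definition ai_cvg (Z : nat -> Type) (rho : forall n, Z n -> Z n -> R)
    (Z0 : Type) (rho0 : Z0 -> Z0 -> R) : Prop :=
  ai_dist (rho n) rho0 @[n --> \oo] --> 0%E.

End AlmostIsometric.

Section PointedGromovHausdorff.
Context {R : realType}.

(* A map from [A] to [B] is given by a total function sending [A] into [B];
   its values outside [A] are irrelevant. *)
Definition gh_isometry (X Y : metricType R) (A : set X) (B : set Y) (eps : R)
    (f : X -> Y) : Prop :=
  [/\ forall a, A a -> B (f a),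
      (ereal_sup [set `|mdist (f u.1) (f u.2) - mdist u.1 u.2|%:E |
                   u in A `*` A] < eps%:E)%E &
      forall b, B b -> exists2 a, A a & cball (f a) eps b].

Definition pointed_gh_cvg (X : nat -> metricType R) (p : forall n, X n)
    (X0 : metricType R) (p0 : X0) : Prop :=
  forall r eps : R, 0 < r -> 0 < eps ->
    exists n0 : nat, forall n, (n0 <= n)%N ->
      exists2 f : X n -> X0,
        gh_isometry (cball (p n) r) (cball p0 r) eps f & f (p n) = p0.

End PointedGromovHausdorff.

(* Main.v *)
(* Let d denote the distance to the base point. On the limit X0, the distance is
   the maximum of the differences of the finitely many Busemann functions,
   because geodesic segments can be prolonged to boundary points. Every boundary
   point has an antipode seen from every point of X0, again by prolongation, and
   this forces the Busemann functions at a point z with d(z) large to be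
   determined by d(z) and by one end of X0: outside a ball, X0 is a disjoint union
   of rays, one for each boundary point.

   If a ball of X_n is almost isometric to a ball of X0, then around radius T the
   space X_n looks like a segment near each branch. Let p be a point there, and q,
   q' the points at small distance delta before and after p. A geodesic from a
   point w to p can be prolonged beyond p, and both sides follow the segment;
   hence w is never equidistant from q and q' unless it is delta-close to p. By
   the intermediate value theorem every geodesic joining the two sides passes
   delta-close to p. So distances in X_n across branches are additive up to
   O(delta), even between points arbitrarily far away, and the Gromov products of
   boundary points of X_n in different branches are those of X0 up to O(delta),
   while those in the same branch are at least T - 1. Sending each boundary point
   of X_n to its branch is the required almost isometry. *)

Require Import Defs.
From mathcomp Require Import all_boot all_order all_algebra.
From mathcomp Require Import all_classical all_reals all_analysis.
From mathcomp Require Import lra.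

Set Implicit Arguments.
Unset Strict Implicit.
Unset Printing Implicit Defensive.

Import Order.TTheory GRing.Theory Num.Theory.
Import numFieldNormedType.Exports.

Local Open Scope classical_set_scope.
Local Open Scope ring_scope.

(** * Geodesics and equidistant points on them *)

Section MetricGeodesics.
Context {R : realType} (X : metricType R).

Lemma extended_geodesic (hg : geodesic_space X)
    (hc : geodesically_complete X) (x y : X) :
  exists c : R -> X, [/\ forall s t, mdist (c s) (c t) = `|s - t|,
    c 0 = x & c (mdist x y) = y].
Proof.
have [c [gc c0 c1]] := hg x y.
have [c' gc' e] := hc _ _ _ (mdist_ge0 x y) gc.
exists c'; split; first by move=> s t; exact: gc'.
  by rewrite e ?c0// lexx mdist_ge0.
by rewrite e ?c1// lexx mdist_ge0.
Qed.

Lemma mdist_lipschitz (x y z : X) : `|mdist x z - mdist y z| <= mdist x y.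
Proof.
have := metric_triangle x y z; have := metric_triangle y x z.
rewrite (metric_sym y x) => h1 h2.
by rewrite ler_norml; apply/andP; split; lra.
Qed.

Lemma mdist_geodesic_continuous (c : R -> X) (q : X) :
  (forall s t, mdist (c s) (c t) = `|s - t|) ->
  continuous (fun t => mdist (c t) q).
Proof.
move=> hc t; apply/cvgrPdist_le => e e0.
near=> s.
apply: (le_trans (mdist_lipschitz _ _ _)); rewrite hc.
near: s; exact: (@cvgr_dist_le _ _ _ _ _ id t (@cvg_id _ _)).
Unshelve. all: by end_near. Qed.

(** The difference of the distances to [q] and [q'] changes sign along a geodesic from [w] to [w'],
    so it vanishes at some [v] on it. *)
Lemma equidistant_on_geodesic (hg : geodesic_space X)
    (hc : geodesically_complete X) (q q' w w' : X) :
  mdist w q <= mdist w q' -> mdist w' q' <= mdist w' q ->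
  exists v, mdist w w' = mdist w v + mdist v w' /\ mdist v q = mdist v q'.
Proof.
move=> h h'.
have [c [gc c0 c1]] := extended_geodesic hg hc w w'.
have [] := @IVT R (fun t => mdist (c t) q - mdist (c t) q') 0 (mdist w w') 0.
- exact: mdist_ge0.
- apply: continuous_subspaceT => t.
  by apply: cvgB; exact: mdist_geodesic_continuous.
- by rewrite c0 c1 ge_min le_max subr_le0 h (subr_ge0 (mdist w' q')) h' orbT.
move=> t; rewrite in_itv/= => /andP[t0 t1] /subr0_eq e.
exists (c t); split => //.
rewrite -[in X in _ = X]c1 -{2}c0 !gc sub0r normrN ger0_norm// distrC ger0_norm; lra.
Qed.

End MetricGeodesics.

(** * Gromov products on the compactification *)

Lemma gromov_product_sym (R : realType) (X : metricType R) (x y z : X) :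
  gromov_product x y z = gromov_product x z y.
Proof. by rewrite /gromov_product (metric_sym y z) (addrC (mdist y x)). Qed.

Lemma gromov_product_base (R : realType) (X : metricType R) (x z u v : X) :
  gromov_product z u v = gromov_product x u v + mdist x z
    - gromov_product x u z - gromov_product x v z.
Proof.
rewrite /gromov_product (metric_sym z x).
by rewrite !(metric_sym _ z) !(metric_sym _ x); lra.
Qed.

Lemma gromov_product_itv (R : realType) (X : metricType R) (x y z : X) :
  0 <= gromov_product x y z <= mdist x z.
Proof.
rewrite /gromov_product.
have := metric_triangle y x z; have := metric_triangle y z x.
by rewrite (metric_sym z x); lra.
Qed.

Section Compactification.
Context {R : realType} (X : metricType R) (K : gpCompactification X).
Local Notation inj := (@gpc_inj _ _ K).
Local Notation P := (@gpc_prod _ _ K).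
Implicit Types (x z w : X) (u v xi eta : gpc_space K).

Lemma near_inj u (U : set (gpc_space K)) : nbhs u U -> exists w, U (inj w).
Proof.
rewrite nbhsE => -[V [oV Vu] VU].
have [|y [/VU Uy [w _ we]]] := gpc_dense _ oV; first by exists u.
by exists w; rewrite we.
Qed.

Lemma gpc_prod_continuousl x v : continuous (fun u => P x u v).
Proof.
move=> u.
apply: (@continuous_comp _ _ _ (fun u => (u, v)) (fun p => P x p.1 p.2) u).
  by apply: cvg_pair; [exact: cvg_id | exact: cvg_cst].
exact: gpc_prod_continuous.
Qed.

Lemma gpc_prod_continuousr x u : continuous (fun v => P x u v).
Proof.
move=> v.
apply: (@continuous_comp _ _ _ (fun v => (u, v)) (fun p => P x p.1 p.2) v).
  by apply: cvg_pair; [exact: cvg_cst | exact: cvg_id].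
exact: gpc_prod_continuous.
Qed.

Lemma closed_near (F : gpc_space K -> \bar R) (A : set \bar R) u U :
  continuous F -> closed A -> nbhs u U ->
  (forall w, U (inj w) -> A (F (inj w))) -> A (F u).
Proof.
move=> cF cA nU h; apply: contrapT => nA.
have : nbhs u (F @^-1` (~` A)).
  by apply: cF; apply: open_nbhs_nbhs; split => //; exact: closed_openC.
by move=> nV; have [w [/h]] := near_inj (filterI nU nV).
Qed.

Lemma gpc_prod_closed x (A : set \bar R) u v U V :
  closed A -> nbhs u U -> nbhs v V ->
  (forall w w', U (inj w) -> V (inj w') -> A (gromov_product x w w')%:E) ->
  A (P x u v).
Proof.
move=> cA nU nV h; apply: (closed_near (@gpc_prod_continuousl x v) cA nU).
move=> w Uw; apply: (closed_near (@gpc_prod_continuousr x (inj w)) cA nV).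
by move=> w' Vw'; rewrite gpc_prodE; exact: h.
Qed.

Lemma gpc_prod_approx x u v (r e : R) : P x u v = r%:E -> 0 < e ->
  exists U V, [/\ nbhs u U, nbhs v V & forall w w', U (inj w) -> V (inj w') ->
    `|gromov_product x w w' - r| < e].
Proof.
move=> Pr e0.
have : nbhs (u, v) ((fun p => P x p.1 p.2) @^-1` (EFin @` ball r e)).
  apply: gpc_prod_continuous => /=; rewrite Pr; apply/nbhs_EFin.
  by near=> y; exists y => //; near: y; exact: nbhsx_ballx.
case=> -[U V] /= [nU nV] UV; exists U, V; split => // w w' Uw Vw'.
have [y] := UV (inj w, inj w') (conj Uw Vw').
by rewrite /ball/= gpc_prodE distrC => ye [<-].
Unshelve. all: by end_near. Qed.

(** Symmetry on [X] survives by density: one pair [w], [w'] approximates both values. *)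
Lemma gpc_prod_sym x u v (r s : R) : P x u v = r%:E -> P x v u = s%:E -> r = s.
Proof.
move=> hr hs; apply/eqP; rewrite -subr_eq0 -normr_le0.
apply/ler_addgt0Pl => e e0; rewrite addr0.
have e2 : 0 < e / 2 by rewrite divr_gt0.
have [U [V [nU nV UV]]] := gpc_prod_approx hr e2.
have [V' [U' [nV' nU' UV']]] := gpc_prod_approx hs e2.
have [w [Uw Uw']] := near_inj (filterI nU nU').
have [w' [Vw Vw']] := near_inj (filterI nV nV').
have := UV _ _ Uw Vw; have := UV' _ _ Vw' Uw'.
rewrite (gromov_product_sym x w') !ltr_norml ler_norml => /andP[? ?] /andP[? ?].
by apply/andP; split; lra.
Qed.

Lemma gpc_prod_fin x u z : exists2 a : R, P x u (inj z) = a%:E &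
  0 <= a <= mdist x z.
Proof.
have h : [set y : \bar R | 0%:E <= y <= (mdist x z)%:E]%E (P x u (inj z)).
  apply: (closed_near (@gpc_prod_continuousl x (inj z)) _ filterT).
    rewrite (_ : mkset _ = [set y | 0%:E <= y]%E `&` [set y | y <= (mdist x z)%:E]%E).
      by apply: closedI; [exact: closed_ereal_le_ereal|exact: closed_ereal_ge_ereal].
    by apply/seteqP; split => y /= /andP.
  by move=> w _ /=; rewrite gpc_prodE !lee_fin gromov_product_itv.
move: h => /=; case: (P x u (inj z)) => [a| |]//=; first by rewrite !lee_fin; exists a.
by rewrite leye_eq andbF.
Qed.

Lemma gpc_prod_base x z u v (r s a b : R) :
  P x u v = r%:E -> P z u v = s%:E ->
  P x u (inj z) = a%:E -> P x v (inj z) = b%:E ->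
  s = r + mdist x z - a - b.
Proof.
move=> hr hs ha hb; apply/eqP; rewrite -subr_eq0 -normr_le0.
apply/ler_addgt0Pl => e e0; rewrite addr0.
have e4 : 0 < e / 4 by rewrite divr_gt0.
have [U1 [V1 [nU1 nV1 UV1]]] := gpc_prod_approx hr e4.
have [U2 [V2 [nU2 nV2 UV2]]] := gpc_prod_approx hs e4.
have [U3 [Z3 [nU3 nZ3 UZ3]]] := gpc_prod_approx ha e4.
have [V4 [Z4 [nV4 nZ4 VZ4]]] := gpc_prod_approx hb e4.
have [w [[w1 w2] w3]] := near_inj (filterI (filterI nU1 nU2) nU3).
have [w' [[v1 v2] v4]] := near_inj (filterI (filterI nV1 nV2) nV4).
move: (UV1 _ _ w1 v1) (UV2 _ _ w2 v2) (UZ3 _ _ w3 (nbhs_singleton nZ3)).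
move: (VZ4 _ _ v4 (nbhs_singleton nZ4)).
rewrite (gromov_product_base x z w w') !ltr_norml ler_norml.
by move=> /andP[? ?] /andP[? ?] /andP[? ?] /andP[? ?]; apply/andP; split; lra.
Qed.

Local Notation bd := (~` range inj).

Lemma boundary_prod_fin x xi eta : bd xi -> bd eta -> xi <> eta ->
  exists2 r : R, P x xi eta = r%:E & 0 <= r.
Proof.
move=> bx be ne; have := gpc_prod_ge0 x xi eta.
have := gpc_prod_pinfty x bx be.
case: (P x xi eta) => [r _|[h _]|]//; first by exists r.
by exfalso; apply: ne; exact: h.
Qed.

Lemma boundary_prodxx x xi : bd xi -> P x xi xi = +oo%E.
Proof. by move=> bx; apply/(gpc_prod_pinfty x bx bx). Qed.

(** A cluster point of the ray rather than its limit: compactness supplies one at once, and closed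
    conditions still pass to it. *)
Definition ray_limit (c : R -> X) xi : Prop :=
  forall (U : set (gpc_space K)) (N : R), nbhs xi U ->
    exists2 t, N <= t & U (inj (c t)).

(** A cluster point [inj y] would have the finite self-product [mdist (c 0) y], whereas that of
    [c t] is [t], which is unbounded. *)
Lemma ray_limit_exists (c : R -> X) :
  (forall s t, mdist (c s) (c t) = `|s - t|) ->
  exists2 xi, bd xi & ray_limit c xi.
Proof.
move=> hc.
pose F := (inj \o c) @ +oo%R.
have [xi [_ cxi]] := @gpc_compact _ _ K F _ filterT.
have hxi : ray_limit c xi.
  move=> U N nU.
  have FN : F [set inj (c t) | t in [set t | N <= t]].
    by apply: filterS (nbhs_pinfty_ge (num_real N)) => t Nt; exists t.
  by have [_ [[t Nt <-] Ut]] := cxi _ _ FN nU; exists t.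
exists xi => // -[y _ ye].
have Py : P (c 0) xi xi = (mdist (c 0) y)%:E.
  rewrite -ye gpc_prodE /gromov_product mdistxx (metric_sym y) subr0.
  by congr EFin; lra.
have [U [V [nU nV UV]]] := gpc_prod_approx Py ltr01.
have [t ht [Ut Vt]] := hxi _ (mdist (c 0) y + 1) (filterI nU nV).
have := UV _ _ Ut Vt.
have t0 : 0 <= t by have := mdist_ge0 (c 0) y; lra.
rewrite /gromov_product mdistxx !hc !subr0 (ger0_norm t0).
rewrite ltr_norml => /andP[? ?]; move: ht; apply/negP; rewrite -ltNge; lra.
Qed.

Lemma ray_limit_closed (c : R -> X) xi (F : gpc_space K -> \bar R)
    (A : set \bar R) (N : R) :
  ray_limit c xi -> continuous F -> closed A ->
  (forall t, N <= t -> A (F (inj (c t)))) -> A (F xi).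
Proof.
move=> cxi cF cA h; apply: contrapT => nA.
have : nbhs xi (F @^-1` (~` A)).
  by apply: cF; apply: open_nbhs_nbhs; split => //; exact: closed_openC.
by move=> /(cxi _ N)[t /h].
Qed.

Lemma closed_ereal1 (a : \bar R) : closed [set a].
Proof.
by apply: accessible_closed_set1; apply: hausdorff_accessible; exact: ereal_hausdorff.
Qed.

Hypothesis hg : geodesic_space X.
Hypothesis hc : geodesically_complete X.

(** A geodesic from [z] to [w] is prolonged to infinity; past [w], the product of [c t] and [w]
    based at [z] is constant. *)
Lemma shadow z w : exists2 xi, bd xi & P z xi (inj w) = (mdist z w)%:E.
Proof.
have [c [gc c0 c1]] := extended_geodesic hg hc z w.
have [xi bxi cxi] := ray_limit_exists gc.
exists xi => //.
apply: (ray_limit_closed (N := mdist z w) cxi (@gpc_prod_continuousl z (inj w))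
  (@closed_ereal1 _)) => t ht /=.
rewrite gpc_prodE /gromov_product; congr EFin.
have m0 := mdist_ge0 z w.
rewrite (metric_sym w z) -{1}c0 -[in X in _ - X]c1 !gc subr0 !ger0_norm//; lra.
Qed.

Lemma opposite z w : exists2 xi, bd xi & P z (inj w) xi = 0%E.
Proof.
have [c [gc c0 c1]] := extended_geodesic hg hc w z.
have [xi bxi cxi] := ray_limit_exists gc.
exists xi => //.
apply: (ray_limit_closed (N := mdist w z) cxi (@gpc_prod_continuousr z (inj w))
  (@closed_ereal1 _)) => t ht /=.
rewrite gpc_prodE /gromov_product; congr EFin.
have m0 := mdist_ge0 w z.
rewrite -[in X in _ + X - _]c1 -[in X in _ - X]c0 !gc.
rewrite sub0r normrN !ger0_norm//; lra.
Qed.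

(** The points having an antipode form a finite union of closed sets, which contains the dense image
    of [X] by [opposite]. *)
Lemma antipode xi z : finite_set bd -> exists2 eta, bd eta & P z xi eta = 0%E.
Proof.
move=> fin.
pose S := \bigcup_(eta in bd) [set u | P z u eta = 0%E].
have cS : closed S.
  apply: closed_bigcup => // eta _.
  rewrite (_ : mkset _ = (fun u => P z u eta) @^-1` [set 0%E])//.
  apply: closed_comp; last exact: closed_ereal1.
  by move=> u _; exact: gpc_prod_continuousl.
have : S xi.
  apply: contrapT => nS.
  have [|w] := @near_inj xi (~` S).
    by apply: open_nbhs_nbhs; split => //; exact: closed_openC.
  by apply; have [eta be h] := opposite z w; exists eta.
by case=> eta be h; exists eta.
Qed.

End Compactification.

(** * Spaces almost isometric to a star-shaped space on a large ball *)

Section Star.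
Context {R : realType}.

(* Outside the ball of radius [C], [X] consists of disjoint rays indexed by
   [I], where [g i j] is the Gromov product of the ends [i] and [j]. *)
Definition star_outside (X : metricType R) (x0 : X) (I : Type)
    (g : I -> I -> R) (C : R) (kappa : X -> I) : Prop :=
  [/\ forall z w, C <= mdist x0 z -> C <= mdist x0 w -> kappa z = kappa w ->
        mdist z w = `|mdist x0 z - mdist x0 w|,
      forall z w, C <= mdist x0 z -> C <= mdist x0 w -> kappa z <> kappa w ->
        mdist z w = mdist x0 z + mdist x0 w - 2 * g (kappa z) (kappa w) &
      forall i s, C <= s -> exists2 z, mdist x0 z = s & kappa z = i].

Context (X Y : metricType R) (x0 : X) (y0 : Y) (I : Type) (g : I -> I -> R).
Context (C T dl e : R) (kappa : X -> I) (f : Y -> X).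
Hypothesis X_star : star_outside x0 g C kappa.
Hypothesis g_leC : forall i j, i <> j -> 4 * g i j <= C.
Hypothesis C_ge4 : 4 <= C.
Hypothesis T_geC : C + 1 <= T.
Hypothesis dl_gt0 : 0 < dl.
Hypothesis dl_lt : 4 * dl <= 1.
Hypothesis e_gt0 : 0 < e.
Hypothesis e_lt : 100 * e <= dl.
Hypothesis Y_geodesic : geodesic_space Y.
Hypothesis Y_complete : geodesically_complete Y.
Hypothesis f_dist : forall a b, mdist y0 a <= T + 1 -> mdist y0 b <= T + 1 ->
  `|mdist (f a) (f b) - mdist a b| <= e.
Hypothesis f_onto : forall z, mdist x0 z <= T + 1 ->
  exists2 a, mdist y0 a <= T + 1 & mdist (f a) z <= e.
Hypothesis f_base : f y0 = x0.

Local Ltac lra_ctx :=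
  move: C_ge4 T_geC dl_gt0 dl_lt e_gt0 e_lt => ? ? ? ? ? ?; lra.

Let f_dist_le a b : mdist y0 a <= T + 1 -> mdist y0 b <= T + 1 ->
  mdist (f a) (f b) - e <= mdist a b <= mdist (f a) (f b) + e.
Proof.
by move=> ha hb; have := f_dist ha hb; rewrite ler_norml => /andP[? ?]; lra_ctx.
Qed.

Let f_radius a : mdist y0 a <= T + 1 ->
  mdist x0 (f a) - e <= mdist y0 a <= mdist x0 (f a) + e.
Proof.
by move=> ha; rewrite -f_base; apply: f_dist_le => //; rewrite mdistxx; lra_ctx.
Qed.

Let X_same z w : C <= mdist x0 z -> C <= mdist x0 w -> kappa z = kappa w ->
  mdist z w = `|mdist x0 z - mdist x0 w|.
Proof. by case: X_star => + _ _; apply. Qed.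

Let X_diff z w : C <= mdist x0 z -> C <= mdist x0 w -> kappa z <> kappa w ->
  mdist z w = mdist x0 z + mdist x0 w - 2 * g (kappa z) (kappa w).
Proof. by case: X_star => _ + _; apply. Qed.

(** As [f] is only almost onto, [b] stands for the point at radius [s] on ray [i] up to an error [e]
    in the image. *)
Definition branch_point (i : I) (s : R) (b : Y) : Prop :=
  mdist y0 b <= T + 1 /\
  exists z, [/\ mdist x0 z = s, kappa z = i & mdist (f b) z <= e].

Lemma branch_point_exists i s : C <= s <= T + 1 -> exists b, branch_point i s b.
Proof.
move=> /andP[h1 h2]; case: X_star => _ _ /(_ i s h1)[z hz kz].
have [|a ha az] := f_onto (z := z); first by rewrite hz.
by exists a; split => //; exists z.
Qed.

Lemma branch_point_radius i s b : branch_point i s b ->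
  s - 2 * e <= mdist y0 b <= s + 2 * e.
Proof.
move=> [hb [z [hz kz fz]]]; have := f_radius hb.
have := metric_triangle x0 z (f b); have := metric_triangle x0 (f b) z.
by rewrite (metric_sym z) hz => ? ? /andP[? ?]; apply/andP; split; lra_ctx.
Qed.

Lemma near_branch_point i s b a r : C <= s -> branch_point i s b ->
  mdist y0 a <= T + 1 -> C + e <= mdist y0 a -> kappa (f a) = i ->
  s - r <= mdist y0 a <= s + r -> mdist a b <= r + 3 * e.
Proof.
move=> Cs [hb [z [hz kz fz]]] ha Ca ka /andP[h1 h2].
have /andP[r1 r2] := f_radius ha.
have faz : mdist (f a) z <= r + e.
  rewrite X_same ?hz ?kz//; last by lra_ctx.
  by rewrite ler_norml; apply/andP; split; lra_ctx.
have /andP[q1 q2] := f_dist_le ha hb.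
have := metric_triangle (f a) z (f b); rewrite (metric_sym z); lra_ctx.
Qed.

Lemma same_branch_of_close z w : C <= mdist x0 z -> C <= mdist x0 w ->
  mdist z w <= 1 -> kappa z = kappa w.
Proof.
move=> hz hw zw; apply: contrapT => k.
by move: zw; rewrite X_diff//; have := g_leC k; lra_ctx.
Qed.

(** * The bottleneck at one branch *)

Section Branch.
Context (i : I) (p qm qp : Y).
Hypothesis hp : branch_point i T p.
Hypothesis hm : branch_point i (T - dl) qm.
Hypothesis hq : branch_point i (T + dl) qp.

Let kappa_near_p a : mdist a p <= dl -> kappa (f a) = i /\
  mdist y0 a <= T + 1 /\ T - 1 + e <= mdist y0 a.
Proof.
move=> ap; have /andP[p1 p2] := branch_point_radius hp.
have ya : mdist y0 a <= T + 1.
  by have := metric_triangle y0 p a; rewrite (metric_sym p); lra_ctx.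
have ya' : T - 1 + e <= mdist y0 a.
  by have := metric_triangle y0 a p; lra_ctx.
split=> //.
have [hpT [z [hz kz fz]]] := hp; rewrite -kz.
have /andP[a1 a2] := f_radius ya; have /andP[f1 f2] := f_dist_le ya hpT.
apply: same_branch_of_close; [lra_ctx | lra_ctx |].
by have := metric_triangle (f a) (f p) z; lra_ctx.
Qed.

(* A geodesic from [w] to [p] can be prolonged beyond [p]; near [p] it follows
   the branch, so it passes close to exactly one of [qm] and [qp] before [p],
   and close to the other one afterwards. *)
Lemma not_equidistant w : dl <= mdist w p -> mdist w qm <> mdist w qp.
Proof.
move=> hw eqm.
have [c [gc c0 c1]] := extended_geodesic Y_geodesic Y_complete p w.
rewrite metric_sym in hw.
set L := mdist p w in hw c1.
(* [c] runs from [p] to [w], so [a] lies between them and [b] on the prolongation beyond [p]. *)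
set a := c dl; set b := c (- dl).
have ap : mdist a p = dl by rewrite -c0 gc subr0 gtr0_norm.
have bp : mdist b p = dl by rewrite -c0 gc subr0 normrN gtr0_norm.
have ab : mdist a b = 2 * dl by rewrite gc opprK gtr0_norm; lra_ctx.
have aw : mdist w a = L - dl by rewrite -c1 gc ger0_norm; lra_ctx.
have bw : mdist w b = L + dl by rewrite -c1 gc ger0_norm; lra_ctx.
have [ka [ya1 ya2]] : kappa (f a) = i /\ mdist y0 a <= T + 1 /\
  T - 1 + e <= mdist y0 a by apply: kappa_near_p; lra_ctx.
have [kb [yb1 yb2]] : kappa (f b) = i /\ mdist y0 b <= T + 1 /\
  T - 1 + e <= mdist y0 b by apply: kappa_near_p; lra_ctx.
have [hpT [z [hz kz fz]]] := hp.
have /andP[a1 a2] := f_radius ya1; have /andP[b1 b2] := f_radius yb1.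
have fab : mdist (f a) (f b) = `|mdist x0 (f a) - mdist x0 (f b)|.
  by apply: X_same; [lra_ctx | lra_ctx | rewrite ka kb].
have faz : mdist (f a) z = `|mdist x0 (f a) - mdist x0 z|.
  by apply: X_same; [lra_ctx | lra_ctx | rewrite ka kz].
have fbz : mdist (f b) z = `|mdist x0 (f b) - mdist x0 z|.
  by apply: X_same; [lra_ctx | lra_ctx | rewrite kb kz].
have /andP[u1 u2] := f_dist_le ya1 yb1.
have /andP[v1 v2] := f_dist_le ya1 hpT.
have /andP[w1 w2] := f_dist_le yb1 hpT.
have t1 := metric_triangle (f a) (f p) z.
have t2 := metric_triangle (f b) (f p) z.
have near u q s : kappa (f u) = i -> mdist y0 u <= T + 1 ->
    T - 1 + e <= mdist y0 u -> branch_point i s q -> C <= s ->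
    s - 4 * e <= mdist y0 u <= s + 4 * e -> `|mdist w u - mdist w q| <= 7 * e.
  move=> ku yu1 yu2 hs Cs us.
  have := near_branch_point Cs hs yu1 _ ku us => /(_ ltac:(lra_ctx)) uq.
  rewrite !(metric_sym w); apply: le_trans (mdist_lipschitz _ _ _) _; lra_ctx.
have {}faz : `|mdist x0 (f a) - T| <= dl + 2 * e by rewrite -hz -faz; lra_ctx.
have {}fbz : `|mdist x0 (f b) - T| <= dl + 2 * e by rewrite -hz -fbz; lra_ctx.
have {}fab : 2 * dl - e <= `|mdist x0 (f a) - mdist x0 (f b)| by rewrite -fab; lra_ctx.
move: faz fbz; rewrite !ler_norml => /andP[? ?] /andP[? ?].
(* Whichever of [a] and [b] is the outer one, they are within [7 * e] of [qp] and [qm] in some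
   order, while their distances to [w] differ by [2 * dl]. *)
have [h|h] := leP (mdist x0 (f b)) (mdist x0 (f a)).
  have Ta : T + dl - 3 * e <= mdist x0 (f a).
    by move: fab; rewrite ger0_norm ?subr_ge0//; lra_ctx.
  have Tb : mdist x0 (f b) <= T - dl + 3 * e.
    by move: fab; rewrite ger0_norm ?subr_ge0//; lra_ctx.
  have := near a qp (T + dl) ka ya1 ya2 hq.
  have := near b qm (T - dl) kb yb1 yb2 hm.
  rewrite !ler_norml eqm aw bw => /(_ ltac:(lra_ctx) ltac:(lra_ctx))/andP[? ?].
  move=> /(_ ltac:(lra_ctx) ltac:(lra_ctx))/andP[? ?]; lra_ctx.
have Tb : T + dl - 3 * e <= mdist x0 (f b).
  by move: fab; rewrite ltr0_norm ?subr_lt0//; lra_ctx.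
have Ta : mdist x0 (f a) <= T - dl + 3 * e.
  by move: fab; rewrite ltr0_norm ?subr_lt0//; lra_ctx.
have := near b qp (T + dl) kb yb1 yb2 hq.
have := near a qm (T - dl) ka ya1 ya2 hm.
rewrite !ler_norml eqm aw bw => /(_ ltac:(lra_ctx) ltac:(lra_ctx))/andP[? ?].
move=> /(_ ltac:(lra_ctx) ltac:(lra_ctx))/andP[? ?]; lra_ctx.
Qed.

(** Some point [v] of a geodesic from [w] to [w'] is equidistant from [qm] and [qp], hence
    [dl]-close to [p]; replacing [v] by [p] costs [2 * dl]. *)
Lemma bottleneck w w' : mdist w qm <= mdist w qp -> mdist w' qp <= mdist w' qm ->
  mdist w p + mdist p w' - 2 * dl <= mdist w w'.
Proof.
move=> h h'.
have [v [-> vq]] := equidistant_on_geodesic Y_geodesic Y_complete h h'.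
have vp : mdist v p < dl.
  by rewrite ltNge; apply/negP => /not_equidistant; apply.
have := metric_triangle w v p; have := metric_triangle p v w'.
rewrite (metric_sym p v); lra_ctx.
Qed.

Lemma base_below : mdist y0 qm <= mdist y0 qp.
Proof.
by have := branch_point_radius hm; have := branch_point_radius hq; lra_ctx.
Qed.

End Branch.

(** * Gromov products within and across branches *)

Section Branches.
Context (p qm qp : I -> Y).
Hypothesis hp : forall i, branch_point i T (p i).
Hypothesis hm : forall i, branch_point i (T - dl) (qm i).
Hypothesis hq : forall i, branch_point i (T + dl) (qp i).

(** Comparing two distances makes sense also for points far outside the ball that [f] controls. *)
Definition beyond (i : I) (w : Y) : Prop := mdist w (qp i) <= mdist w (qm i).

Let bp_dist i j s t a b : i <> j -> C <= s -> C <= t -> branch_point i s a ->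
  branch_point j t b ->
  s + t - 2 * g i j - 3 * e <= mdist a b <= s + t - 2 * g i j + 3 * e.
Proof.
move=> ij Cs Ct [ha [z [hz kz fz]]] [hb [z' [hz' kz' fz']]].
have := f_dist_le ha hb.
have := X_diff (z := z) (w := z'); rewrite hz hz' kz kz' => /(_ Cs Ct ij).
have := metric_triangle (f a) z (f b); have := metric_triangle z z' (f b).
have := metric_triangle z (f a) z'; have := metric_triangle (f a) (f b) z'.
rewrite (metric_sym z' (f b)) (metric_sym z (f a)) => ? ? ? ? ? /andP[? ?].
by move: fz fz' => ? ?; apply/andP; split; lra_ctx.
Qed.

Lemma not_beyond_p i j : i <> j -> mdist (p i) (qm j) <= mdist (p i) (qp j).
Proof.
move=> ij.
have Cm : C <= T - dl by lra_ctx. have Cq : C <= T + dl by lra_ctx.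
have CT : C <= T by lra_ctx.
have := bp_dist ij CT Cm (hp i) (hm j).
have := bp_dist ij CT Cq (hp i) (hq j).
by lra_ctx.
Qed.

(** Otherwise geodesics from [p j] to [w] nearly pass through [p i], and conversely. Adding both
    inequalities gives [mdist (p i) (p j) <= 2 * dl], which is absurd. *)
Lemma beyond_uniq i j w : beyond i w -> beyond j w -> i = j.
Proof.
move=> bi bj; apply: contrapT => ij.
have CT : C <= T by lra_ctx.
have h1 := bottleneck (hp i) (hm i) (hq i) (not_beyond_p (nesym ij)) bi.
have h2 := bottleneck (hp j) (hm j) (hq j) (not_beyond_p ij) bj.
have := bp_dist ij CT CT (hp i) (hp j).
by rewrite (metric_sym (p j)) in h1; have := g_leC ij; lra_ctx.
Qed.

(** A geodesic from [y0] to [w] crosses the radii [T - dl] and [T + dl] at points of one branch,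
    [3 * e]-close to its [qm] and [qp]. *)
Lemma beyond_exists w : T + 1 <= mdist y0 w -> exists i, beyond i w.
Proof.
move=> hw.
have [c [gc c0 c1]] := extended_geodesic Y_geodesic Y_complete y0 w.
set L := mdist y0 w in hw c1.
have yc s : 0 <= s -> mdist y0 (c s) = s.
  by move=> s0; rewrite -c0 gc sub0r normrN ger0_norm.
have wc s : s <= L -> mdist w (c s) = L - s.
  by move=> sL; rewrite -c1 gc ger0_norm// subr_ge0.
set a := c (T - dl); set b := c (T + dl).
have ya : mdist y0 a = T - dl by rewrite yc//; lra_ctx.
have yb : mdist y0 b = T + dl by rewrite yc//; lra_ctx.
have ab : mdist a b = 2 * dl by rewrite gc ltr0_norm; lra_ctx.
have ha : mdist y0 a <= T + 1 by lra_ctx.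
have hb : mdist y0 b <= T + 1 by lra_ctx.
have := f_radius ha; have := f_radius hb; have := f_dist_le ha hb => ? ? ?.
have kab : kappa (f a) = kappa (f b) by apply: same_branch_of_close; lra_ctx.
exists (kappa (f a)); rewrite /beyond.
have h1 : mdist a (qm (kappa (f a))) <= 3 * e.
  rewrite -[leRHS]add0r.
  by apply: near_branch_point (hm _) _ _ _ _ => //; lra_ctx.
have h2 : mdist b (qp (kappa (f a))) <= 3 * e.
  rewrite -[leRHS]add0r.
  by apply: near_branch_point (hq _) _ _ _ _ => //; lra_ctx.
have := metric_triangle w b (qp (kappa (f a))).
have := metric_triangle w (qm (kappa (f a))) a.
rewrite !wc; try lra_ctx.
by rewrite (metric_sym (qm _) a); lra_ctx.
Qed.

Lemma beyond_dist_le i w : beyond i w ->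
  mdist w (p i) <= mdist y0 w - T + 3 * dl.
Proof.
move=> bi.
have := bottleneck (hp i) (hm i) (hq i) (base_below (hm i) (hq i)) bi.
by have := branch_point_radius (hp i); rewrite (metric_sym w); lra_ctx.
Qed.

Lemma gromov_product_same_branch i w w' : beyond i w -> beyond i w' ->
  T - 3 * dl <= gromov_product y0 w w'.
Proof.
move=> /beyond_dist_le bi /beyond_dist_le bi'; rewrite /gromov_product.
have := metric_triangle w (p i) w'; rewrite (metric_sym (p i)).
rewrite (metric_sym w y0) (metric_sym w' y0) in bi bi' *.
by move: bi bi'; rewrite !(metric_sym y0); lra_ctx.
Qed.

(** Two bottlenecks show that going from [w] to [w'] through [p i] and [p j] lengthens the path by
    at most [4 * dl]. *)
Lemma gromov_product_diff_branch i j w w' : i <> j -> T + 1 <= mdist y0 w ->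
  T + 1 <= mdist y0 w' -> beyond i w -> beyond j w' ->
  `|gromov_product y0 w w' - g i j| <= 4 * dl.
Proof.
move=> ij hw hw' bi bj.
have CT : C <= T by lra_ctx.
have ni : mdist w' (qm i) <= mdist w' (qp i).
  rewrite leNgt; apply/negP => /ltW b.
  exact: ij (beyond_uniq b bj).
have h1 := bottleneck (hp i) (hm i) (hq i) ni bi.
have h2 := bottleneck (hp j) (hm j) (hq j) (not_beyond_p ij) bj.
have := bp_dist ij CT CT (hp i) (hp j) => /andP[d1 d2].
have e1 := beyond_dist_le bi; have e2 := beyond_dist_le bj.
have t1 := metric_triangle w (p i) w'.
have t2 := metric_triangle (p i) (p j) w'.
have t3 := metric_triangle y0 (p i) w.
have t4 := metric_triangle y0 (p j) w'.
have := branch_point_radius (hp i); have := branch_point_radius (hp j).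
move=> /andP[? ?] /andP[? ?].
move: h1 h2 d1 d2 e1 e2 t1 t2 t3 t4; rewrite /gromov_product.
rewrite (metric_sym w y0) (metric_sym w' y0) (metric_sym w' w).
rewrite (metric_sym w' (p i)) (metric_sym w (p i)) (metric_sym w' (p j)).
by move=> *; rewrite ler_norml; apply/andP; split; lra_ctx.
Qed.

End Branches.

(** [F] maps a boundary point to the one branch containing all points of [Y] near it; bounds on
    products then pass to the limit. *)
Lemma boundary_classes (K : gpCompactification Y) :
  exists F : (~` range (@gpc_inj _ _ K)) -> I,
  [/\ forall i, exists xi, F xi = i,
    forall xi eta, F xi = F eta ->
      ((T - 1)%:E <= gpc_prod y0 (\val xi) (\val eta))%E &
    forall xi eta, F xi <> F eta ->
      exists2 r, gpc_prod y0 (\val xi) (\val eta) = r%:E &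
        `|r - g (F xi) (F eta)| <= 4 * dl].
Proof.
pose inj := @gpc_inj _ _ K; pose bd := ~` range inj.
have bp s : C <= s <= T + 1 -> exists b : I -> Y,
    forall i, branch_point i s (b i).
  move=> hs; suff /choice[b hb] : forall i, exists b, branch_point i s b.
    by exists b.
  by move=> i; exact: branch_point_exists.
have [|p hp] := bp T; first by lra_ctx.
have [|qm hm] := bp (T - dl); first by lra_ctx.
have [|qp hq] := bp (T + dl); first by lra_ctx.
pose far i w := T + 1 <= mdist y0 w /\ beyond qm qp i w.
have far_same i w w' : far i w -> far i w' -> T - 1 <= gromov_product y0 w w'.
  move=> [_ h] [_ h'].
  by have := gromov_product_same_branch hp hm hq h h'; lra_ctx.
have far_diff i j w w' : i <> j -> far i w -> far j w' ->
    `|gromov_product y0 w w' - g i j| <= 4 * dl.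
  move=> ij [hw h] [hw' h'].
  exact: (gromov_product_diff_branch hp hm hq ij hw hw' h h').
have far_exists w : T + 1 <= mdist y0 w -> exists i, far i w.
  by move=> hw; have [i hi] := beyond_exists hm hq hw; exists i.
have close xi : bd xi -> exists2 U, nbhs xi U & forall w w',
    U (inj w) -> U (inj w') -> T + 1 < gromov_product y0 w w'.
  move=> bx.
  have : nbhs (xi, xi) ((fun p => @gpc_prod _ _ K y0 p.1 p.2) @^-1`
      [set y | (T + 1)%:E < y]%E).
    apply: gpc_prod_continuous => /=; rewrite boundary_prodxx//.
    by apply: ereal_nbhs_pinfty_gt; exact: num_real.
  case=> -[U V] /= [nU nV] UV; exists (U `&` V); first exact: filterI.
  move=> w w' [Uw _] [_ Vw'].
  by have := UV (inj w, inj w') (conj Uw Vw'); rewrite /= gpc_prodE lte_fin.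
have cls xi : bd xi -> exists i, exists2 U, nbhs xi U &
    forall w, U (inj w) -> far i w.
  move=> bx; have [U nU hU] := close _ bx.
  have rad w : U (inj w) -> T + 1 <= mdist y0 w.
    move=> Uw; have /andP[_] := gromov_product_itv y0 w w.
    by apply: le_trans; exact/ltW/hU.
  have [w0 Uw0] := near_inj nU.
  have [i hi] := far_exists _ (rad _ Uw0).
  exists i, U => // w Uw; have [j hj] := far_exists _ (rad _ Uw).
  (* Distinct branches would cap the product by [g i j + 4 * dl], below the value [T + 1] exceeded
     on [U]. *)
  rewrite (_ : i = j)//; apply: contrapT => ij.
  have := far_diff _ _ _ _ ij hi hj; rewrite ler_norml => /andP[_].
  apply/negP; rewrite -ltNge.
  by have := hU _ _ Uw0 Uw; have := g_leC ij; lra_ctx.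
have /choice[F hF] : forall xi : bd, exists i, exists2 U, nbhs (\val xi) U &
    forall w, U (inj w) -> far i w.
  by move=> xi; apply: cls; exact: set_mem (valP xi).
exists F; split.
- move=> i.
  (* A geodesic from [y0] through [qp i] stays beyond branch [i], so its limit is a preimage of
     [i]. *)
  have [c [gc c0 c1]] := extended_geodesic Y_geodesic Y_complete y0 (qp i).
  have [xi bx cxi] := ray_limit_exists K gc.
  exists (SigSub (mem_set bx : xi \in bd)); set xi' := SigSub _.
  have [U nU hU] := hF xi'.
  have [t ht Ut] := cxi _ (T + 2) nU.
  have [_ hj] := hU _ Ut; apply: (beyond_uniq hp hm hq hj); rewrite /beyond.
  have /andP[q1 q2] := branch_point_radius (hq i).
  have /andP[q3 q4] := branch_point_radius (hm i).
  have tq : mdist (c t) (qp i) = t - mdist y0 (qp i).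
    by rewrite -{1}c1 gc ger0_norm//; lra_ctx.
  have ty : mdist y0 (c t) = t by rewrite -c0 gc sub0r normrN ger0_norm//; lra_ctx.
  have := metric_triangle y0 (qm i) (c t).
  by rewrite ty (metric_sym (qm i)) tq; lra_ctx.
- move=> xi eta e'.
  have [U nU hU] := hF xi; have [V nV hV] := hF eta.
  apply: (gpc_prod_closed (A := [set y | (T - 1)%:E <= y]%E) _ nU nV).
    exact: closed_ereal_le_ereal.
  move=> w w' /hU h /hV; rewrite -e' => h'; rewrite /= lee_fin.
  exact: far_same h h'.
- move=> xi eta ne.
  have [U nU hU] := hF xi; have [V nV hV] := hF eta.
  set G := g _ _.
  have : [set y | (G - 4 * dl)%:E <= y <= (G + 4 * dl)%:E]%E
      (@gpc_prod _ _ K y0 (\val xi) (\val eta)).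
    apply: (gpc_prod_closed _ nU nV).
      rewrite (_ : mkset _ = [set y | (G - 4 * dl)%:E <= y]%E `&`
        [set y | y <= (G + 4 * dl)%:E]%E); last first.
        by apply/seteqP; split => y /= /andP.
      by apply: closedI; [exact: closed_ereal_le_ereal|
        exact: closed_ereal_ge_ereal].
    move=> w w' /hU h /hV h'; rewrite /= !lee_fin.
    by have := far_diff _ _ _ _ ne h h'; rewrite -/G ler_norml; lra.
  case: (gpc_prod y0 _ _) => [r||] /=; last 2 first.
  - by rewrite leye_eq andbF.
  - by [].
  rewrite !lee_fin => h; exists r => //; rewrite ler_norml; lra.
Qed.

End Star.

(** * Spaces with finite boundary *)

Section FiniteBoundary.
Context {R : realType} (X : metricType R) (K : gpCompactification X) (x0 : X).
Local Notation inj := (@gpc_inj _ _ K).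
Local Notation P := (@gpc_prod _ _ K).
Local Notation bd := (~` range inj).
Local Notation D := (mdist x0).
Implicit Types (z w : X) (xi eta : gpc_space K).

Lemma boundary_prod_sym x xi eta : bd xi -> bd eta -> P x xi eta = P x eta xi.
Proof.
move=> bx be; have [->//|/eqP ne] := eqVneq xi eta.
have [r hr _] := boundary_prod_fin x bx be ne.
have [s hs _] := boundary_prod_fin x be bx (nesym ne).
by rewrite hr hs (gpc_prod_sym hr hs).
Qed.

(** [D z - 2 * a] is the Busemann function of [xi] at [z], normalized to vanish at [x0]. The
    difference of its values is [2 * s - mdist z w], where [s] is the product of [xi] and [w] based
    at [z]. *)
Lemma busemann_lipschitz z w xi (a b : R) :
  P x0 xi (inj z) = a%:E -> P x0 xi (inj w) = b%:E ->
  `|(D z - 2 * a) - (D w - 2 * b)| <= mdist z w.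
Proof.
move=> ha hb.
have [s hs /andP[s0 s1]] := gpc_prod_fin z xi w.
have := gpc_prod_base hb hs ha (gpc_prodE _ x0 w z).
rewrite /gromov_product (metric_sym w z) (metric_sym w) (metric_sym z x0) => e.
by rewrite ler_norml; apply/andP; split; lra.
Qed.

Hypothesis hg : geodesic_space X.
Hypothesis hc : geodesically_complete X.
Hypothesis fin : finite_set bd.

(** The Lipschitz bound is attained at the shadow of [w] seen from [z], where that product equals
    [mdist z w]. *)
Lemma mdist_busemann z w : exists xi (a b : R),
  [/\ bd xi, P x0 xi (inj z) = a%:E, P x0 xi (inj w) = b%:E &
      mdist z w = (D z - 2 * a) - (D w - 2 * b)].
Proof.
have [xi bx hs] := shadow K hg hc z w.
have [a ha _] := gpc_prod_fin x0 xi z; have [b hb _] := gpc_prod_fin x0 xi w.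
exists xi, a, b; split => //.
have := gpc_prod_base hb hs ha (gpc_prodE _ x0 w z).
rewrite /gromov_product (metric_sym w z) (metric_sym w) (metric_sym z x0); lra.
Qed.

Lemma boundary_prod_bounded : exists2 G : R, 0 <= G & forall xi eta (r : R),
  bd xi -> bd eta -> P x0 xi eta = r%:E -> r <= G.
Proof.
have [s hs] := (finite_seqP _).1 (finite_setX fin fin).
(* On the diagonal [fine] turns [+oo] into 0, which does not affect the maximum. *)
exists (\big[Num.max/0]_(p <- s) fine (P x0 p.1 p.2)).
  exact: bigmax_ge_id.
move=> xi eta r bx be h.
have ps : (xi, eta) \in s.
  have : (bd `*` bd) (xi, eta) by [].
  by rewrite hs.
rewrite -[r]/(fine r%:E) -h.
exact: (@le_bigmax_seq _ _ _ _ _ (xi, eta) xpredT (fun p => fine (P x0 p.1 p.2))).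
Qed.

(* [xi] is the end of [X] in which the point [z] lies. *)
Definition in_end xi z : Prop := [/\ bd xi, P x0 xi (inj z) = (D z)%:E &
  forall eta, bd eta -> eta <> xi -> P x0 eta (inj z) = P x0 xi eta].

Context (G : R).
Hypothesis G_ge0 : 0 <= G.
Hypothesis prod_leG : forall xi eta (r : R),
  bd xi -> bd eta -> P x0 xi eta = r%:E -> r <= G.

(* If the antipode [zeta] of [eta] seen from [z] were not [xi], then both
   [(eta|z)] and [(zeta|z)] would be bounded by [G], and [(eta|zeta)_z >= D z - 2 G]
   would be positive. *)
Lemma in_end_exists z : 2 * G < D z -> exists xi, in_end xi z.
Proof.
move=> hz.
have [xi bx hx] := shadow K hg hc x0 z; exists xi; split => // eta be ne.
(* This is the nonnegativity of the product of [xi] and [zeta] based at [z], which equals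
   [r - a]. *)
have bound zeta (a : R) : bd zeta -> zeta <> xi -> P x0 zeta (inj z) = a%:E ->
    exists r : R, [/\ P x0 xi zeta = r%:E, a <= r & r <= G].
  move=> bz nz ha.
  have [r hr _] := boundary_prod_fin x0 bx bz (nesym nz).
  have [s hs s0] := boundary_prod_fin z bx bz (nesym nz).
  exists r; split => //; last exact: prod_leG hr.
  by have := gpc_prod_base hr hs hx ha; lra.
have [zeta bz h0] := antipode hg hc eta z fin.
have [a ha _] := gpc_prod_fin x0 eta z.
have [b hb _] := gpc_prod_fin x0 zeta z.
have [r [hr ar rG]] := bound _ _ be ne ha.
have nez : eta <> zeta.
  by move=> e; move: h0; rewrite -e boundary_prodxx.
have [q hq q0] := boundary_prod_fin x0 be bz nez.
have := gpc_prod_base hq h0 ha hb.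
(* When the antipode is [xi], the base change formula reduces to the wanted equality [a = r]. *)
have [zx|/eqP nzx] := eqVneq zeta xi.
  move: hb hq; rewrite zx hx boundary_prod_sym// hr => -[<-] [<-] e.
  by rewrite ha; congr EFin; lra.
have [r' [hr' ar' rG']] := bound _ _ bz nzx hb.
move=> e; exfalso; move: hz; apply/negP; rewrite -leNgt; lra.
Qed.

(** The Busemann function of [xi] is [- D] on this end, and every other one is [D] plus a
    constant. *)
Lemma in_end_mdist_same xi z w : in_end xi z -> in_end xi w ->
  mdist z w = `|D z - D w|.
Proof.
move=> [bx hz kz] [_ hw kw].
apply/eqP; rewrite eq_le !(metric_sym x0) mdist_lipschitz andbT !(metric_sym _ x0).
have [eta [a [b [be ha hb ->]]]] := mdist_busemann z w.
have [e|/eqP ne] := eqVneq eta xi.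
  move: ha hb; rewrite e hz hw => -[<-] [<-].
  by rewrite distrC; apply: le_trans (ler_norm _); lra.
move: ha hb; rewrite kz// kw// => -> [<-].
by apply: le_trans (ler_norm _); lra.
Qed.

(** The Busemann function of [eta] gives the lower bound. By [mdist_busemann] some Busemann
    difference equals the distance, and beyond radius [2 * G] none exceeds this value. *)
Lemma in_end_mdist_diff xi eta z w : xi <> eta -> in_end xi z -> in_end eta w ->
  2 * G < D z -> 2 * G < D w ->
  mdist z w = D z + D w - 2 * fine (P x0 xi eta).
Proof.
move=> ne [bx hz kz] [be hw kw] Dz Dw.
have [r hr r0] := boundary_prod_fin x0 bx be ne; rewrite hr /=.
have rG := prod_leG bx be hr.
have hez := kz _ be (nesym ne); rewrite hr in hez.
have hxw := kw _ bx ne; rewrite (boundary_prod_sym _ be bx) hr in hxw.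
apply/eqP; rewrite eq_le; apply/andP; split; last first.
  have := busemann_lipschitz hez hw; rewrite ler_norml => /andP[_ h]; lra.
have [zeta [a [b [bz ha hb ->]]]] := mdist_busemann z w.
have [e|/eqP nx] := eqVneq zeta xi.
  by move: ha hb; rewrite e hz hxw => -[<-] [<-]; lra.
have [e|/eqP ny] := eqVneq zeta eta.
  by move: ha hb; rewrite e hez hw => -[<-] [<-]; lra.
have a0 : 0 <= a by rewrite -lee_fin -ha gpc_prod_ge0.
move: hb; rewrite (kw _ bz ny) => /(prod_leG be bz); lra.
Qed.

(** A point [w] close to [xi] lies in its end. The point [z] at radius [s] on a geodesic from [x0]
    to [w] lies in the same end, since otherwise [z] and [w] would be too far apart. *)
Lemma in_end_surj xi (s : R) : bd xi -> 2 * G < s ->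
  exists2 z, D z = s & in_end xi z.
Proof.
move=> bx hs; have G0 := G_ge0.
have [U [V [nU nV UV]]] : exists U V, [/\ nbhs xi U, nbhs xi V &
    forall w w', U (inj w) -> V (inj w') -> s < gromov_product x0 w w'].
  have : nbhs (xi, xi) ((fun p => P x0 p.1 p.2) @^-1` [set y | s%:E < y]%E).
    apply: gpc_prod_continuous => /=; rewrite boundary_prodxx//.
    by apply: ereal_nbhs_pinfty_gt; exact: num_real.
  case=> -[U V] /= [nU nV] UV; exists U, V; split => // w w' Uw Vw'.
  by have := UV (inj w, inj w') (conj Uw Vw'); rewrite /= gpc_prodE lte_fin.
have [w Vw] := near_inj nV.
have [b hb /andP[b0 bw]] := gpc_prod_fin x0 xi w.
have sb : s <= b.
  have : [set y | s%:E <= y]%E (P x0 xi (inj w)).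
    apply: (closed_near (@gpc_prod_continuousl _ _ _ x0 (inj w)) _ nU).
      exact: closed_ereal_le_ereal.
    by move=> w' Uw' /=; rewrite gpc_prodE lee_fin ltW//; exact: UV.
  by rewrite /= hb lee_fin.
have [c [gc c0 c1]] := extended_geodesic hg hc x0 w.
pose z := c s.
have Dz : D z = s by rewrite -c0 gc sub0r normrN ger0_norm//; lra.
have zw : mdist z w = D w - s by rewrite -{1}c1 gc distrC ger0_norm//; lra.
have [eta ez] := in_end_exists (z := z) ltac:(by rewrite Dz).
have [eta' ew] := in_end_exists (z := w) ltac:(lra).
have e' : eta' = xi.
  have [//|/eqP ne] := eqVneq eta' xi.
  have [be _ /(_ _ bx (nesym ne))] := ew.
  rewrite hb => /esym/(prod_leG be bx) bG.
  by exfalso; move: hs; apply/negP; rewrite -leNgt; lra.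
exists z => //; suff -> : xi = eta by [].
apply: contrapT => ne; rewrite -e' in ne.
have := in_end_mdist_diff ne ew ez ltac:(lra) ltac:(lra).
have [bx' _ _] := ew; have [be _ _] := ez.
have [r hr r0] := boundary_prod_fin x0 bx' be ne; have rG := prod_leG bx' be hr.
rewrite hr /= metric_sym zw Dz => e; move: hs; apply/negP; rewrite -leNgt; lra.
Qed.

End FiniteBoundary.

Lemma finite_boundary_star (R : realType) (X : gromovProductSpace R) (x0 : X) :
  finite_set (boundary X) ->
  let g (i j : boundary X) :=
    fine (@gpc_prod _ _ (gps_compactification X) x0 (\val i) (\val j)) in
  exists (C : R) (kappa : X -> boundary X), [/\ 4 <= C,
    forall i j, i <> j -> 4 * g i j <= C & star_outside x0 g C kappa].
Proof.
move=> fin g.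
have hg := @gps_geodesic _ X; have hc := @gps_complete _ X.
have [G G0 prodG] := boundary_prod_bounded x0 fin.
have bdP (i : boundary X) : @boundary _ X (\val i) by exact: set_mem (valP i).
have valN (i j : boundary X) : i <> j -> \val i <> \val j.
  by move=> ij /val_inj.
have [xi0 b0 _] := shadow (gps_compactification X) hg hc x0 x0.
have /choice[kappa hk] : forall z : X, exists i : boundary X,
    2 * G < mdist x0 z -> in_end x0 (\val i) z.
  move=> z; have [h|h] := ltP (2 * G) (mdist x0 z).
    have [xi hxi] := in_end_exists hg hc fin prodG h.
    have [bxi _ _] := hxi.
    by exists (SigSub (mem_set bxi : xi \in boundary X)).
  (* Inside the ball of radius [2 * G] the value of [kappa] is an arbitrary default. *)
  by exists (SigSub (mem_set b0 : xi0 \in boundary X)).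
have uniq_end (i j : boundary X) z : 2 * G < mdist x0 z ->
    in_end x0 (\val i) z -> in_end x0 (\val j) z -> i = j.
  move=> hz [_ hi _] [_ hj kj]; apply: contrapT => ij.
  have := kj _ (bdP i) (valN _ _ ij); rewrite hi => /esym.
  by move=> /(prodG _ _ _ (bdP j) (bdP i)); apply/negP; rewrite -ltNge; lra.
(* This constant is at least 4, bounds [4 * g i j], and exceeds [2 * G]. *)
exists (4 * G + 4), kappa; split; first by lra.
  move=> i j ij; rewrite /g.
  have [r hr _] := boundary_prod_fin x0 (bdP i) (bdP j) (valN _ _ ij).
  by rewrite hr /=; have := prodG _ _ _ (bdP i) (bdP j) hr; lra.
split.
- move=> z w hz hw kzw.
  apply: (in_end_mdist_same hg hc (hk z _)); first by lra.
  by rewrite kzw; apply: hk; lra.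
- move=> z w hz hw /valN kzw.
  by apply: (in_end_mdist_diff hg hc prodG kzw);
    [apply: hk|apply: hk| |]; lra.
- move=> i s hs.
  have [|z hz iz] := in_end_surj hg hc fin G0 prodG (bdP i) (s := s); first by lra.
  exists z => //.
  have hz' : 2 * G < mdist x0 z by rewrite hz; lra.
  exact: uniq_end hz' (hk z hz') iz.
Qed.

(** * Almost-isometric convergence *)

(** For [r <= s], factoring out [expR (- r) <= 1] leaves [1 - expR (- (s - r))], at most [s - r]. *)
Lemma expRN_lipschitz (R : realType) (r s : R) : 0 <= r -> 0 <= s ->
  `|expR (- r) - expR (- s)| <= `|r - s|.
Proof.
wlog rs : r s / r <= s => [H|] r0 s0.
  have [rs|/ltW sr] := leP r s; first exact: H.
  by rewrite distrC (distrC r); exact: H.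
rewrite (ger0_norm (x := expR _ - _)); last by rewrite subr_ge0 ler_expR lerN2.
rewrite distrC ger0_norm ?subr_ge0//.
have -> : - s = - r + - (s - r) by lra.
rewrite expRD -{1}[expR (- r)]mulr1 -mulrBr.
have e1 : expR (- r) <= 1 by rewrite -expR0 ler_expR; lra.
have := expR_ge1Dx (- (s - r)) => e2.
have e3 : expR (- (s - r)) <= 1 by rewrite -expR0 ler_expR; lra.
apply: le_trans (_ : 1 * (1 - expR (- (s - r))) <= _); last by lra.
by apply: ler_wpM2r => //; lra.
Qed.

Section BoundaryRho.
Context {R : realType} (X : gromovProductSpace R) (x : X).
Implicit Types xi eta : boundary X.
Local Notation P := (@gpc_prod _ _ (gps_compactification X)).

Lemma boundary_rho_fin xi eta (r : R) : P x (\val xi) (\val eta) = r%:E ->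
  boundary_rho x xi eta = expR (- r).
Proof. by rewrite /boundary_rho => ->. Qed.

Lemma boundary_rhoxx xi : boundary_rho x xi xi = 0.
Proof.
by rewrite /boundary_rho boundary_prodxx//; exact: set_mem (valP xi).
Qed.

Lemma boundary_rho_ge0 xi eta : 0 <= boundary_rho x xi eta.
Proof. by rewrite /boundary_rho fine_ge0// expeR_ge0. Qed.

Lemma boundary_rho_le xi eta (t : R) : (t%:E <= P x (\val xi) (\val eta))%E ->
  boundary_rho x xi eta <= expR (- t).
Proof.
rewrite /boundary_rho; case: (P _ _ _) => [r| |]//=.
by rewrite lee_fin ler_expR lerN2.
Qed.

End BoundaryRho.

Lemma ai_isometry_intro (R : realType) (Z1 Z2 : Type) (rho1 : Z1 -> Z1 -> R)
    (rho2 : Z2 -> Z2 -> R) (eps e : R) (f : Z1 -> Z2) : e < eps ->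
  (forall u v, `|rho2 (f u) (f v) - rho1 u v| <= e) ->
  (forall v, exists u, rho2 (f u) v < eps) -> ai_isometry rho1 rho2 eps f.
Proof.
move=> ee h s; split => //; apply: (@le_lt_trans _ _ e%:E); last by rewrite lte_fin.
by apply: ge_ereal_sup => _ [[u v] _ <-]; rewrite lee_fin; exact: h.
Qed.

Section AiDist.
Context {R : realType} (Z1 Z2 : Type) (rho1 : Z1 -> Z1 -> R)
  (rho2 : Z2 -> Z2 -> R).

Lemma ai_dist_ge0 : (0 <= ai_dist rho1 rho2)%E.
Proof.
by apply: le_ereal_inf_tmp => _ [eps [eps0 _ _] <-]; rewrite lee_fin ltW.
Qed.

(** Any right inverse of [f] has the same distortion bound, and is almost onto because [rho2]
    vanishes on the diagonal. *)
Lemma ai_dist_le (e eps : R) (f : Z1 -> Z2) : 0 <= e < eps ->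
  (forall v, exists u, f u = v) -> (forall v, rho2 v v = 0) ->
  (forall u v, `|rho2 (f u) (f v) - rho1 u v| <= e) ->
  (ai_dist rho1 rho2 <= eps%:E)%E.
Proof.
move=> /andP[e0 ee] /choice[g fg] rho2xx h.
apply: ereal_inf_lbound; exists eps => //; split.
- exact: le_lt_trans ee.
- exists f; apply: (ai_isometry_intro ee h) => v; exists (g v).
  by rewrite fg rho2xx; exact: le_lt_trans ee.
- exists g; apply: (ai_isometry_intro ee) => [u v|u].
    by rewrite distrC -{1}(fg u) -{1}(fg v).
  exists (f u); have := h (g (f u)) u.
  by rewrite fg rho2xx sub0r normrN; move/(le_trans (ler_norm _))/le_lt_trans; apply.
Qed.

End AiDist.

Theorem theorem1p6 (R : realType)
    (X : nat -> gromovProductSpace R) (x : forall n : nat, X n)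
    (X0 : gromovProductSpace R) (x0 : X0) :
  (forall n : nat, maximal_gps (X n)) ->
  maximal_gps X0 ->
  finite_set (boundary X0) ->
  pointed_gh_cvg x x0 ->
  ai_cvg (fun n : nat => boundary_rho (x n)) (boundary_rho x0).
Proof.
move=> _ _ fin gh.
have [C [kappa [C4 gC star]]] := finite_boundary_star x0 fin.
suff small (eps : R) : 0 < eps -> exists n0 : nat, forall n, (n0 <= n)%N ->
    (ai_dist (boundary_rho (x n)) (boundary_rho x0) <= eps%:E)%E.
  rewrite /ai_cvg => A; rewrite -[0%E]/(0%R%:E) => /nbhs_EFin[eps /= eps0 hA].
  have [|n0 hn] := small (eps / 2); first by rewrite divr_gt0.
  exists n0 => // n /hn; have := ai_dist_ge0 (boundary_rho (x n)) (boundary_rho x0).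
  rewrite /=; case: (ai_dist _ _) => [r| |]//.
  rewrite !lee_fin => r0 re; apply: hA.
  by rewrite /ball/= sub0r normrN ger0_norm//; lra.
move=> eps0.
(* The error [4 * dl] on products is then at most [eps / 2]. *)
pose dl := Num.min (1 / 4) (eps / 8); pose e := dl / 100.
have dl0 : 0 < dl by rewrite lt_min !divr_gt0.
have dl1 : dl <= 1 / 4 by rewrite ge_min lexx.
have dl2 : dl <= eps / 8 by rewrite ge_min lexx orbT.
have e0 : 0 < e by rewrite divr_gt0.
(* As [T <= expR (T - 1)], the bound [2 / eps <= T] makes [expR (- (T - 1))] at most [eps / 2]. *)
pose T := Num.max (C + 1) (2 / eps).
have CT : C + 1 <= T by rewrite le_max lexx.
have eT : expR (- (T - 1)) <= eps / 2.
  have T0 : 0 < T by lra.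
  have h : T <= expR (T - 1) by have := expR_ge1Dx (T - 1); lra.
  rewrite expRN invf_ple ?posrE ?expR_gt0 ?divr_gt0// invf_div.
  by apply: le_trans h; rewrite le_max lexx orbT.
have [||n0 hn0] := gh (T + 1) e; [by lra | exact: e0 |].
exists n0 => n /hn0[f [fball fsup fonto] fx].
have [||||F [Fsurj Fsame Fdiff]] := boundary_classes star gC C4 CT dl0 _ e0 _
  (@gps_geodesic _ (X n)) (@gps_complete _ (X n)) _ _ fx (gps_compactification (X n)).
- lra.
- rewrite /e; lra.
- move=> a b ha hb; rewrite -lee_fin; apply/ltW; apply: le_lt_trans fsup.
  by apply: ereal_sup_ubound; exists (a, b).
- by move=> z /fonto[a ha az]; exists a.
apply: (@ai_dist_le _ _ _ _ _ (eps / 2) eps F); first by lra.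
- by move=> v; have [u <-] := Fsurj v; exists u.
- exact: boundary_rhoxx.
(* In one branch the limit value is 0 and the other at most [expR (- (T - 1))]; across branches the
   products are close and the exponential is Lipschitz. *)
move=> u v; have [uv|/eqP uv] := eqVneq (F u) (F v).
  rewrite uv boundary_rhoxx sub0r normrN ger0_norm ?boundary_rho_ge0//.
  exact: le_trans (boundary_rho_le (Fsame _ _ uv)) eT.
have [r hr rg] := Fdiff _ _ uv.
have bdF w : boundary X0 (\val (F w)) by exact: set_mem (valP (F w)).
have [|s hs s0] := boundary_prod_fin x0 (bdF u) (bdF v).
  by move/val_inj.
rewrite (boundary_rho_fin hr) (boundary_rho_fin hs).
have r0 : 0 <= r by rewrite -lee_fin -hr gpc_prod_ge0.
apply: le_trans (expRN_lipschitz s0 r0) _.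
by move: rg; rewrite hs /= distrC; lra.
Qed.
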